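(* Let $n\ge0$ and let $\sigma,\tau\in\mathrm{Typ}(n)$ be types of $n$. The coefficient of $H_\tau$ in the expansion of $E^+_\sigma$ in the basis $\{H_\rho:\rho\in\mathrm{Typ}(n)\}$ is $$\sum_{T\in \mathcal{PT}_H^{\mathrm{doub}}(\sigma, \tau)} (-1)^{\ell_2(T)}.$$
   Context: A type of $n$ is a sequence $\tau=(\tau|^1,\tau|^2,\dots)$ of (possibly empty) integer partitions with $\sum_{i\ge1} i\,|\tau|^i|=n$, where $|\tau|^i|$ is the size of the partition $\tau|^i$; $\mathrm{Typ}(n)$ is the set of types of $n$. Each part $d$ of $\tau|^r$ gives a block $d^r$ of $\tau$ (degree $d$, multiplicity $r$; not exponentiation); a type is thus a multiset of blocks. Let $x_{i,j}$ ($i,j\ge 1$) be indeterminates with $\deg x_{i,j}=i$; all series have rational coefficients. A monomial is square-free if every exponent is at most $1$. $H_d$ is the sum of all monomials of degree $d$; $E^+_d$ is the sum of all square-free monomials of degree $d$. For $F\in\{H,E^+\}$, $F_{d^r}$ is obtained from $F_d$ by replacing each $x_{i,j}$ by $x_{i,j}^r$, and $F_\tau=\prod F_{d^r}$ over all blocks $d^r$ of $\tau$ (counted with repetition; empty product $=1$). It is known that $\{F_\tau\}_{\tau\in\mathrm{Typ}(n)}$ is, for each such $F$, a $\mathbb{Q}$-basis of the space $\mathrm{PSym}(n)$ of polysymmetric functions of degree $n$ (power series homogeneous of degree $n$ that are symmetric separately in each variable set $\{x_{i,j}\}_{j\ge1}$). The diagram of a partition $\lambda$ has left-justified rows of $\lambda_1,\lambda_2,\dots$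 cells; the tensor diagram of $\sigma$ is the sequence of diagrams of $\sigma|^1,\sigma|^2,\dots$, the $i$th one being called the $i$th tensor factor. A brick is a nonempty set of consecutive cells in one row; its length is its number of cells. A doublebrick is a brick of even length marked with a $+$ sign (and is distinguished from unmarked bricks, simply called bricks). A double polybrick tabloid of shape $\sigma$ and content $\tau$ is a decomposition of the tensor diagram of $\sigma$ into disjoint bricks and doublebricks such that, in each row, all doublebricks appear to the right of all bricks, and such that $\tau$ is the multiset of blocks obtained by taking a block $a^m$ for each brick of length $a$ in the $m$th tensor factor and a block $b^{2m}$ for each doublebrick of length $2b$ in the $m$th tensor factor. $\mathcal{PT}_H^{\mathrm{doub}}(\sigma,\tau)$ is the set of double polybrick tabloids of shape $\sigma$ and content $\tau$ with at most one (unmarked) brick in each row. For such $T$, $\ell_2(T)$ is the number of doublebricks in $T$. *)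

(* Defs.v *)
From HB Require Import structures.
From mathcomp Require Import all_boot all_order all_algebra.
From mathcomp Require Import finmap boolp.
From mathcomp Require Import monalg.

Set Implicit Arguments.
Unset Strict Implicit.
Unset Printing Implicit Defensive.

Import GRing.Theory.
Local Open Scope ring_scope.

(* Monomials in the indeterminates x_{i,j}, i, j >= 1: the pair (i, j) of type
   nat * nat stands for x_{i+1,j+1}. *)
Notation monom := {cmonom (nat * nat)%type}.

Definition wdeg (m : monom) : nat := (\sum_(v <- finsupp m) m v * v.1.+1)%N.

Definition squarefree (m : monom) : bool :=
  [forall v : finsupp m, m (val v) <= 1]%N.

Definition mdivisors (m : monom) : seq monom :=
  [seq [cmonom (phi v : nat) | v : finsupp m]%M
     | phi : {dffun forall v : finsupp m, 'I_(m (val v)).+1}].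

Lemma mem_mdivisors (m d : monom) :
  reflect (forall v, (d v <= m v)%N) (d \in mdivisors m).
Proof.
apply: (iffP imageP) => [[phi _ ->] v|le_dm].
  rewrite cmE fsfun_ffun; case: insubP => //= u _ <-.
  by rewrite -ltnS ltn_ord.
have lt_dm (v : finsupp m) : (d (val v) < (m (val v)).+1)%N by rewrite ltnS.
exists (finfun (fun v : finsupp m => Ordinal (lt_dm v))) => //.
apply/eqP/cmP=> v; rewrite cmE fsfun_ffun; case: insubP => [u _ <-|] /=.
  by rewrite ffunE.
by rewrite memNfinsupp => /eqP mv0; move: (le_dm v); rewrite mv0 leqn0 => /eqP.
Qed.

Lemma mdivisors_uniq (m : monom) : uniq (mdivisors m).
Proof.
rewrite map_inj_uniq ?enum_uniq // => phi psi /eqP/cmP eq_phi.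
apply/ffunP=> v; apply/val_inj; have := eq_phi (val v).
by rewrite !cmE !fsfun_ffun !valK.
Qed.

Definition series : Type := monom -> rat.
HB.instance Definition _ := Choice.on series.

Section SeriesRing.
Implicit Types (f g h : series) (m d e : monom).

Definition series0 : series := fun _ => 0.
Definition series_opp f : series := fun m => - f m.
Definition series_add f g : series := fun m => f m + g m.
Definition series1 : series := fun m => (m == (onecm _))%:R.
Definition series_mul f g : series := fun m =>
  \sum_(d <- mdivisors m) f d * g (divcm m d).
Definition series_scale (a : rat) f : series := fun m => a * f m.

Fact series_addA : associative series_add.
Proof. by move=> f g h; apply: funext => m; apply: addrA. Qed.
Fact series_addC : commutative series_add.
Proof. by move=> f g; apply: funext => m; apply: addrC. Qed.
Fact series_add0 : left_id series0 series_add.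
Proof. by move=> f; apply: funext => m; apply: add0r. Qed.
Fact series_addN : left_inverse series0 series_opp series_add.
Proof. by move=> f; apply: funext => m; apply: addNr. Qed.

HB.instance Definition _ := GRing.isZmodule.Build series
  series_addA series_addC series_add0 series_addN.

Lemma divcm_dvd m d : d \in mdivisors m -> divcm m d \in mdivisors m.
Proof. by move=> _; apply/mem_mdivisors => v; rewrite divcmE leq_subr. Qed.

Lemma divcmK m d : d \in mdivisors m -> divcm m (divcm m d) = d.
Proof.
move/mem_mdivisors => le_dm; apply/eqP/cmP=> v.
by rewrite !divcmE subKn.
Qed.

Lemma perm_divcm m : perm_eq [seq divcm m d | d <- mdivisors m] (mdivisors m).
Proof.
apply: uniq_perm; rewrite ?mdivisors_uniq //.
  rewrite map_inj_in_uniq ?mdivisors_uniq // => d e dm em eq_de.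
  by rewrite -(divcmK dm) eq_de divcmK.
move=> d; apply/mapP/idP => [[e em ->]|dm]; first exact: divcm_dvd.
by exists (divcm m d); rewrite ?divcm_dvd ?divcmK.
Qed.

Fact series_mulC : commutative series_mul.
Proof.
move=> f g; apply: funext => m; rewrite /series_mul.
rewrite -(perm_big _ (perm_divcm m)) big_map big_seq [RHS]big_seq.
by apply: eq_bigr => d dm; rewrite divcmK // mulrC.
Qed.

Lemma perm_mul_mdivisors m e : e \in mdivisors m ->
  perm_eq [seq mulcm e d | d <- mdivisors (divcm m e)]
          [seq d <- mdivisors m | e \in mdivisors d].
Proof.
move=> /mem_mdivisors em; apply: uniq_perm.
- rewrite map_inj_in_uniq ?mdivisors_uniq // => d d' _ _ /eqP/cmP eq_d.
  by apply/eqP/cmP => v; have := eq_d v; rewrite !mulcmE => /addnI.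
- by rewrite filter_uniq ?mdivisors_uniq.
move=> d; rewrite mem_filter; apply/mapP/andP => [[c]|[]].
  move=> /mem_mdivisors cm ->; split; apply/mem_mdivisors => v;
    rewrite mulcmE ?leq_addr //.
  by have := cm v; rewrite divcmE leq_subRL.
move=> /mem_mdivisors ed /mem_mdivisors dm; exists (divcm d e).
  by apply/mem_mdivisors => v; rewrite !divcmE leq_sub2r.
by apply/eqP/cmP=> v; rewrite mulcmE divcmE subnKC.
Qed.

Fact series_mulA : associative series_mul.
Proof.
move=> f g h; apply: funext => m; rewrite /series_mul.
pose F e d := f e * g (divcm d e) * h (divcm m d).
transitivity (\sum_(e <- mdivisors m) \sum_(d <- mdivisors m | e \in mdivisors d) F e d).
  rewrite big_seq [RHS]big_seq; apply: eq_bigr => e em.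
  rewrite -[RHS]big_filter -(perm_big _ (perm_mul_mdivisors em)) [RHS]big_map mulr_sumr.
  apply: eq_bigr => d _; rewrite /F mulrA; congr (f e * g _ * h _).
    by apply/eqP/cmP=> v; rewrite divcmE mulcmE addKn.
  by apply/eqP/cmP=> v; rewrite !divcmE mulcmE subnDA.
rewrite (exchange_big_dep xpredT) //= big_seq [RHS]big_seq.
apply: eq_bigr => d /mem_mdivisors dm; rewrite mulr_suml -[LHS]big_filter.
apply: perm_big; apply: uniq_perm; rewrite ?filter_uniq ?mdivisors_uniq //.
move=> e; rewrite mem_filter andbC; apply/andP/idP => [[]//|ed]; split=> //.
by apply/mem_mdivisors => v; apply: leq_trans (dm v); apply/mem_mdivisors: v.
Qed.

Fact series_mul1 : left_id series1 series_mul.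
Proof.
move=> f; apply: funext => m; rewrite /series_mul.
have m1 : (onecm _) \in mdivisors m by apply/mem_mdivisors => v; rewrite onecmE.
rewrite (bigD1_seq (onecm _)) ?mdivisors_uniq //= big1 => [|d /negPf d1].
  rewrite addr0 /series1 eqxx mul1r; congr f.
  by apply/eqP/cmP=> v; rewrite divcmE onecmE subn0.
by rewrite /series1 d1 mul0r.
Qed.

Fact series_mulDl : left_distributive series_mul +%R.
Proof.
move=> f g h; apply: funext => m.
rewrite -[RHS]/(series_mul f h m + series_mul g h m) -big_split /=.
by apply: eq_bigr => d _; rewrite -mulrDl.
Qed.

Fact series_oner_neq0 : series1 != 0.
Proof.
apply/eqP => /(congr1 (@^~ (onecm _))) /eqP.
by rewrite /series1 eqxx -[X in _ == X]/(0 : rat) oner_eq0.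
Qed.

HB.instance Definition _ := GRing.Zmodule_isComNzRing.Build series
  series_mulA series_mulC series_mul1 series_mulDl series_oner_neq0.

Fact series_scaleA a b f :
  series_scale a (series_scale b f) = series_scale (a * b) f.
Proof. by apply: funext => m; apply: mulrA. Qed.
Fact series_scale1 : left_id 1 series_scale.
Proof. by move=> f; apply: funext => m; apply: mul1r. Qed.
Fact series_scaleDr : right_distributive series_scale +%R.
Proof. by move=> a f g; apply: funext => m; apply: mulrDr. Qed.
Fact series_scaleDl f : {morph series_scale^~ f : a b / a + b}.
Proof. by move=> a b; apply: funext => m; apply: mulrDl. Qed.

HB.instance Definition _ := GRing.Zmodule_isLmodule.Build rat series
  series_scaleA series_scale1 series_scaleDr series_scaleDl.

End SeriesRing.

(* Substitution x_{i,j} |-> x_{i,j}^r in f. For r > 0 it sums a single term at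
   most; r = 0 is not a legitimate substitution and is never used. *)
Definition subst_pow (r : nat) (f : series) : series := fun m =>
  \sum_(a <- mdivisors m | expcmn a r == m) f a.

Definition Hser (d : nat) : series := fun m => (wdeg m == d)%:R.

Definition Eplus_ser (d : nat) : series := fun m =>
  ((wdeg m == d) && squarefree m)%:R.

Definition is_partition (s : seq nat) : bool := sorted geq s && (0%N \notin s).

(* The entry of index i of the tuple is the partition tau|^{i+1}; the components
   tau|^i with i > n, which are empty for a type of n, are left out. *)
Record typ (n : nat) : predArgType := Typ {
  typ_val :> n.-tuple (seq nat);
  _ : all is_partition typ_val
      && ((\sum_(i < n) i.+1 * sumn (tnth typ_val i))%N == n)
}.

HB.instance Definition _ n := [isSub for @typ_val n].
HB.instance Definition _ n := [Choice of typ n by <:].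

Section TypFinite.
Variable n : nat.

Lemma typ_part (t : typ n) (i : 'I_n) : is_partition (tnth t i).
Proof. by case/andP: (valP t) => /all_tnthP. Qed.

Lemma typ_size (t : typ n) (i : 'I_n) : (sumn (tnth t i) <= n)%N.
Proof.
case/andP: (valP t) => _ /eqP; rewrite (bigD1 i) //= => eq_n.
by rewrite -[leqRHS]eq_n (leq_trans _ (leq_addr _ _)) // leq_pmull.
Qed.

Lemma sumn_ge_nth (s : seq nat) k : (nth 0 s k <= sumn s)%N.
Proof.
elim: s k => [|x s IHs] [|k] //=; first by rewrite leq_addr.
by rewrite (leq_trans (IHs k)) ?leq_addl.
Qed.

Lemma sumn_ge_size (s : seq nat) : 0%N \notin s -> (size s <= sumn s)%N.
Proof.
elim: s => //= x s IHs; rewrite inE eq_sym negb_or -lt0n => /andP[x0 /IHs].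
by rewrite -addn1 addnC; apply: leq_add.
Qed.

Definition typ_encode (t : typ n) : {ffun 'I_n * 'I_n -> 'I_n.+1} :=
  [ffun p : 'I_n * 'I_n => inord (nth 0%N (tnth t p.1) p.2)].

Definition typ_decode (c : {ffun 'I_n * 'I_n -> 'I_n.+1}) : option (typ n) :=
  insub [tuple [seq k <- [seq (c (i, j) : nat) | j : 'I_n] | k != 0%N] | i < n].

Lemma typ_encodeK : pcancel typ_encode typ_decode.
Proof.
move=> t; rewrite /typ_decode -[RHS](valK t); congr insub.
apply: eq_from_tnth => i; rewrite tnth_mktuple -/(tnth t i).
set s := tnth t i; have /andP[_ s0] : is_partition s := typ_part t i.
have s_n : (size s <= n)%N by rewrite (leq_trans (sumn_ge_size s0)) ?typ_size.
have -> : [seq (typ_encode t (i, j) : nat) | j : 'I_n] = mkseq (nth 0%N s) n.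
  rewrite /image_mem /mkseq -val_enum_ord -map_comp; apply: eq_map => j /=.
  by rewrite ffunE inordK // ltnS (leq_trans (sumn_ge_nth _ _)) ?typ_size.
rewrite /mkseq -(subnKC s_n) iotaD map_cat filter_cat -/(mkseq _ _) mkseq_nth.
rewrite (@eq_in_filter _ _ predT) ?filter_predT => [|k ks]; last first.
  by apply: contraNneq s0 => <-.
rewrite (@eq_in_filter _ _ pred0) ?filter_pred0 ?cats0 // => _ /mapP[k ks ->].
by move: ks; rewrite mem_iota => /andP[? _]; rewrite nth_default.
Qed.
End TypFinite.

HB.instance Definition _ n := [Countable of typ n by <:].
HB.instance Definition _ n : isFinite (typ n) := PCanIsFinite (@typ_encodeK n).

(* The block d^r is encoded as the pair (d, r). *)
Definition blocks n (t : typ n) : seq (nat * nat) :=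
  flatten [seq [seq (d, i.+1) | d <- tnth t i] | i : 'I_n].

Definition of_typ (F : nat -> series) n (t : typ n) : series :=
  \prod_(b <- blocks t) subst_pow b.2 (F b.1).

(* Tensor factors, rows and columns are counted from 0: factor i is the diagram
   of the partition tau|^{i+1}. *)
Definition row_len n (s : typ n) (i : 'I_n) (r : nat) : nat := nth 0%N (tnth s i) r.

(* The tile with fields i, r, c, l, b occupies the columns c, ..., c + l - 1 of
   the row r of the factor i; it is a doublebrick if b = true, and a brick if
   b = false. A row of the tensor diagram of a type of n has at most n cells and
   a factor at most n rows, so the bounds on the fields exclude no tile. *)
Record tile (n : nat) : predArgType := Tile {
  tfactor : 'I_n;
  trow : 'I_n;
  tstart : 'I_n;
  tlen : 'I_n.+1;
  tdouble : bool
}.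

Section TileFinite.
Variable n : nat.
Definition tile_encode (t : tile n) :=
  (tfactor t, trow t, tstart t, tlen t, tdouble t).
Definition tile_decode (p : 'I_n * 'I_n * 'I_n * 'I_n.+1 * bool) : tile n :=
  let: (i, r, c, l, b) := p in Tile i r c l b.
Lemma tile_encodeK : cancel tile_encode tile_decode. Proof. by case. Qed.
End TileFinite.

HB.instance Definition _ n := Finite.copy (tile n) (can_type (@tile_encodeK n)).

Section Tabloids.
Variable n : nat.
Implicit Types (s t : typ n) (u v : tile n) (T : {set tile n}).

Definition same_row u v : bool :=
  (tfactor u == tfactor v) && (trow u == trow v).

Definition covers u (i r c : 'I_n) : bool :=
  [&& tfactor u == i, trow u == r & (tstart u <= c < tstart u + tlen u)%N].

Definition tile_in s u : bool :=
  [&& (0 < tlen u)%N,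
      (tstart u + tlen u <= row_len s (tfactor u) (trow u))%N
    & tdouble u ==> ~~ odd (tlen u)].

(* The last condition: in each row, doublebricks are to the right of bricks. *)
Definition is_tabloid s T : bool :=
  [&& [forall u in T, tile_in s u],
      [forall i : 'I_n, forall r : 'I_n, forall c : 'I_n,
         (c < row_len s i r)%N ==> (#|[set u in T | covers u i r c]| == 1%N)]
    & [forall u in T, forall v in T,
         [&& same_row u v, ~~ tdouble u & tdouble v] ==> (tstart u < tstart v)%N]].

Definition tile_block u : nat * nat :=
  if tdouble u then ((tlen u)./2, 2 * (tfactor u).+1)%N
  else (tlen u : nat, (tfactor u).+1).

Definition has_content t T : bool :=
  perm_eq [seq tile_block u | u in T] (blocks t).

Definition le1_brick_per_row T : bool :=
  [forall i : 'I_n, forall r : 'I_n,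
     (#|[set u in T | [&& tfactor u == i, trow u == r & ~~ tdouble u]]| <= 1)%N].

Definition PT_H_doub s t : {set {set tile n}} :=
  [set T : {set tile n} | [&& is_tabloid s T, has_content t T & le1_brick_per_row T]].

Definition ell2 T : nat := #|[set u in T | tdouble u]|.

End Tabloids.

(* Main.v *)
(** Write F[r] for F with every variable raised to the power r. Each monomial is
    uniquely a squarefree monomial times a square, so H_L is the sum over b of
    E^+_(L-2b) H_b[2]; solving for E^+_L peels the rightmost tile off a row of
    length L, and multiplying over the rows of sigma gives the expansion.

    For uniqueness, give a block d^r the weight d^2 (r+1), and view a monomial as
    the multiset of blocks i^e over its factors x_(i,j)^e. If a monomial occurs in
    H_rho then its weight is at most that of rho, with equality only if its blocks
    are those of rho: d^2 is strictly superadditive in d, and r+1 is strictly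
    subadditive in r. Hence the H_rho are linearly independent. *)
Require Import Defs.
From HB Require Import structures.
From mathcomp Require Import all_boot all_order all_algebra.
From mathcomp Require Import finmap boolp monalg ring zify.

Set Implicit Arguments.
Unset Strict Implicit.
Unset Printing Implicit Defensive.

Import Order.TTheory GRing.Theory Num.Theory.
Local Open Scope ring_scope.

(** * Monomials and coefficients of series *)

Lemma expcmnE (m : monom) r v : expcmn m r v = (r * m v)%N.
Proof.
rewrite /expcmn; case: r => [|r]; first by rewrite onecmE.
by rewrite iteropS; elim: r => [|r IHr]; rewrite ?mul1n // iterS mulcmE IHr mulSn.
Qed.

Lemma expcmn_inj r : (0 < r)%N -> injective (fun m : monom => expcmn m r).
Proof.
move=> r0 m m' /eqP/cmP eq_m; apply/eqP/cmP => v.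
by have /eqP := eq_m v; rewrite !expcmnE eqn_pmul2l // => /eqP.
Qed.

Lemma series_sumE I (s : seq I) (P : pred I) (F : I -> series) m :
  (\sum_(i <- s | P i) F i) m = \sum_(i <- s | P i) F i m.
Proof. exact: (big_morph (fun f : series => f m)). Qed.

Lemma series_scaleE a (f : series) m : (a *: f : series) m = a * f m.
Proof. by []. Qed.

Lemma series_mulE (f g : series) m :
  (f * g) m = \sum_(d <- mdivisors m) f d * g (divcm m d).
Proof. by []. Qed.

Lemma series1E m : (1 : series) m = (m == onecm _)%:R.
Proof. by []. Qed.

Lemma series_mul_neq0 (f g : series) m : (f * g) m != 0 ->
  exists a b, [/\ m = mulcm a b, f a != 0 & g b != 0].
Proof.
rewrite series_mulE big_seq => fg_neq0.
have /hasP[d d_dvd] : has (fun d => f d * g (divcm m d) != 0) (mdivisors m).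
  apply: contraNT fg_neq0 => /hasPn fg0; rewrite big1 // => d /fg0.
  by rewrite negbK => /eqP.
rewrite mulf_eq0 negb_or => /andP[fd gd]; exists d, (divcm m d); split => //.
apply/eqP/cmP => v; rewrite mulcmE divcmE subnKC //.
by have /mem_mdivisors := d_dvd.
Qed.

(** For [r > 0] a monomial has at most one [r]-th root, so a single term of the sum survives. *)
Lemma subst_pow_expcmn r f a : (0 < r)%N -> subst_pow r f (expcmn a r) = f a.
Proof.
move=> r0; rewrite /subst_pow big_mkcond (bigD1_seq a) ?mdivisors_uniq //=; last first.
  by apply/mem_mdivisors => v; rewrite expcmnE leq_pmull.
rewrite eqxx big1 ?addr0 // => b; rewrite (inj_eq (expcmn_inj r0)).
by move=> /negPf->.
Qed.

Lemma subst_pow_neq0 r f m :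
  subst_pow r f m != 0 -> exists2 a, m = expcmn a r & f a != 0.
Proof.
rewrite /subst_pow => f_neq0.
have /hasP[a _ /andP[/eqP <- fa]] :
    has (fun a => (expcmn a r == m) && (f a != 0)) (mdivisors m).
  apply: contraNT f_neq0 => /hasPn f0; rewrite big_seq_cond big1 // => a /andP[/f0].
  by rewrite negb_and => /orP[/negP|/negPn/eqP].
by exists a.
Qed.

Lemma wdegE (m : monom) (D : {fset nat * nat}) : (finsupp m `<=` D)%fset ->
  wdeg m = (\sum_(v <- D) m v * v.1.+1)%N.
Proof.
move=> mD; rewrite /wdeg; apply: big_fset_incl => // v _.
by rewrite -cmE_eq0 => /eqP->.
Qed.

Lemma finsupp_expcmn (a : monom) r : (0 < r)%N ->
  finsupp (expcmn a r) = finsupp a.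
Proof.
by move=> r0; apply/fsetP => v; rewrite -!cmE_neq0 expcmnE -!lt0n muln_gt0 r0.
Qed.

Lemma wdegM (a b : monom) : wdeg (mulcm a b) = (wdeg a + wdeg b)%N.
Proof.
rewrite (wdegE (fsubsetUl (finsupp a) (finsupp b))).
rewrite (wdegE (fsubsetUr (finsupp a) (finsupp b))).
rewrite /wdeg mdomD -big_split; apply: eq_bigr => v _ /=.
by rewrite mulcmE mulnDl.
Qed.

Lemma squarefreeP (m : monom) : reflect (forall v, (m v <= 1)%N) (squarefree m).
Proof.
apply: (iffP forallP) => [m1 v|m1 v]; last exact: m1.
case: (mdomP m v) => // vm; exact: (m1 [` vm]%fset).
Qed.

(** * Square-free and square factors *)

Definition sqfree_part (m : monom) : monom := [cmonom nat_of_bool (odd (m v)) | v in finsupp m]%M.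
Definition half_part (m : monom) : monom := [cmonom (m v)./2 | v in finsupp m]%M.

Lemma sqfree_partE m v : sqfree_part m v = odd (m v).
Proof. by rewrite cmE fsfun_fun; case: mdomP. Qed.

Lemma half_partE m v : half_part m v = (m v)./2.
Proof. by rewrite cmE fsfun_fun; case: mdomP. Qed.

Lemma sqfree_half_part m :
  m = mulcm (sqfree_part m) (mulcm (half_part m) (half_part m)).
Proof.
apply/eqP/cmP => v; rewrite !mulcmE sqfree_partE half_partE addnn.
by rewrite odd_double_half.
Qed.

(** Uniqueness of the factorization: exponents of [e] are 0 or 1, so they are the parities of those
    of [m]. *)
Lemma sqfree_partP (m e a : monom) : squarefree e ->
  m = mulcm e (mulcm a a) -> e = sqfree_part m /\ a = half_part m.
Proof.
move=> /squarefreeP e1 ->; split; apply/eqP/cmP => v.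
  rewrite sqfree_partE !mulcmE addnn oddD odd_double addbF.
  by case: (e v) (e1 v) => [|[]].
rewrite half_partE !mulcmE addnn halfD odd_double andbF doubleK add0n.
by case: (e v) (e1 v) => [|[]].
Qed.

(** Compare coefficients of [m]. Both sides vanish unless [m] is an [r]-th power of some [m0]; then
    the unique factorization of [m0] leaves one divisor, and degrees leave at most one [b]. *)
Lemma Eplus_Hser_sum r L : (0 < r)%N ->
  \sum_(b < L.+1 | (b.*2 <= L)%N)
     subst_pow r (Eplus_ser (L - b.*2)) * subst_pow (2 * r) (Hser b)
  = subst_pow r (Hser L).
Proof.
move=> r0; have r20 : (0 < 2 * r)%N by rewrite muln_gt0.
have expM (e a : monom) : mulcm (expcmn e r) (expcmn a (2 * r)) =
    expcmn (mulcm e (mulcm a a)) r.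
  by apply/eqP/cmP => v; rewrite !(mulcmE, expcmnE); ring.
apply: funext => m; rewrite series_sumE.
(* A nonzero term at the divisor [d] writes [m] as the [r]-th power of a square-free monomial times
   a square. *)
have factor d (b : nat) : subst_pow r (Eplus_ser (L - b.*2)) d
    * subst_pow (2 * r) (Hser b) (divcm m d) != 0 -> d \in mdivisors m ->
    exists e a, [/\ d = expcmn e r, squarefree e & m = expcmn (mulcm e (mulcm a a)) r].
  rewrite mulf_eq0 negb_or => /andP[/subst_pow_neq0[e -> Ee] /subst_pow_neq0[a eq_a _]].
  move=> /mem_mdivisors em; exists e, a; split=> //.
    by move: Ee; rewrite /Eplus_ser pnatr_eq0 eqb0 negbK => /andP[].
  rewrite -expM -eq_a; apply/eqP/cmP => v; rewrite mulcmE divcmE subnKC //.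
under eq_bigr do rewrite series_mulE.
rewrite exchange_big /=.
have [[m0 def_m]|noroot] := pselect (exists m0, m = expcmn m0 r); last first.
  rewrite big_seq big1 => [|d dm]; last first.
    rewrite big1 // => b _; apply/eqP; apply: contra_notT noroot => nz.
    by have [e [a [_ _ ->]]] := factor _ _ nz dm; eexists.
  by apply/esym/eqP; apply: contra_notT noroot => /subst_pow_neq0[a -> _]; exists a.
(* By uniqueness of that factorization, only this divisor can contribute. *)
rewrite (bigD1_seq (expcmn (sqfree_part m0) r)) ?mdivisors_uniq //=; last first.
  apply/mem_mdivisors => v; rewrite def_m !expcmnE leq_mul2l sqfree_partE.
  by case: (m0 v) => [|k]; rewrite ?orbT // (leq_trans (leq_b1 _)) ?orbT.
rewrite [X in _ + X = _]big_seq_cond [X in _ + X = _]big1 ?addr0 => [|d /andP[dm d_neq]]; last first.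
  rewrite big1 // => b _; apply/eqP; apply: contraNT d_neq => nz.
  have [e [a [-> sqf_e]]] := factor _ _ nz dm; rewrite def_m => /(expcmn_inj r0).
  by move=> /(sqfree_partP sqf_e)[-> _].
have -> : divcm m (expcmn (sqfree_part m0) r) = expcmn (half_part m0) (2 * r).
  rewrite def_m {1}(sqfree_half_part m0) -expM.
  by apply/eqP/cmP => v; rewrite divcmE mulcmE addKn.
rewrite def_m subst_pow_expcmn // {2}/Hser.
have := congr1 wdeg (sqfree_half_part m0); rewrite !wdegM addnn => ->.
have sqf : squarefree (sqfree_part m0).
  by apply/squarefreeP => v; rewrite sqfree_partE leq_b1.
set x := wdeg (sqfree_part m0); set y := wdeg (half_part m0).
have coefE b : subst_pow r (Eplus_ser (L - b.*2)) (expcmn (sqfree_part m0) r)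
    * subst_pow (2 * r) (Hser b) (expcmn (half_part m0) (2 * r))
    = ((x == L - b.*2)%N && (y == b))%:R.
  by rewrite !subst_pow_expcmn // /Eplus_ser /Hser sqf andbT -natrM mulnb.
under eq_bigr do rewrite coefE.
have [<-|neq_L] := eqVneq (x + y.*2)%N L; last first.
  by rewrite big1 // => b le_b; case: eqP => //= ?; case: eqP => //= ?; lia.
(* The one surviving index is [b = y], the degree of the half part. *)
have lt_y : (y < (x + y.*2).+1)%N by lia.
rewrite (bigD1 (Ordinal lt_y)) ?leq_addl //= addnK !eqxx big1 ?addr0 // => b.
by move=> /andP[_]; rewrite -val_eqE /= eq_sym => /negPf->; rewrite andbF.
Qed.

Lemma subst_pow_Hser0 r : (0 < r)%N -> subst_pow r (Hser 0) = 1.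
Proof.
move=> r0; have expc1 : expcmn (onecm _ : monom) r = onecm _.
  by apply/eqP/cmP => v; rewrite expcmnE onecmE muln0.
apply: funext => m; rewrite series1E; have [->|neq_m] := eqVneq m (onecm _).
  rewrite -{1}expc1 subst_pow_expcmn // /Hser /wdeg (_ : finsupp _ = fset0).
    by rewrite big_seq_fset0.
  exact: mdom1.
apply/eqP; apply: contraNT neq_m => /subst_pow_neq0[a ->].
rewrite pnatr_eq0 eqb0 negbK => /eqP deg_a; rewrite -expc1; apply/eqP; congr expcmn.
apply/eqP/cmP => v; rewrite onecmE; apply/eqP; apply: contra_eqT deg_a.
rewrite cmE_neq0 => va; rewrite /wdeg (big_fsetD1 v) //= addn_eq0 muln_eq0 orbF.
by rewrite cmE_eq0 va.
Qed.

(** This isolates the term [b = 0]. The term of index [b] will match a doublebrick of length [2b] at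
    the right end of a row, and the leading [H] term a row filled by one brick. *)
Lemma subst_pow_Eplus_rec r L : (0 < r)%N ->
  subst_pow r (Eplus_ser L) = subst_pow r (Hser L)
    - \sum_(b < L.+1 | (0 < b)%N && (b.*2 <= L)%N)
        subst_pow (2 * r) (Hser b) * subst_pow r (Eplus_ser (L - b.*2)).
Proof.
move=> r0; rewrite -(Eplus_Hser_sum _ r0) (bigD1 ord0) //= subn0.
rewrite subst_pow_Hser0 ?muln_gt0 // mulr1 -addrA -[LHS]addr0; congr (_ + _).
apply/esym/eqP; rewrite subr_eq0; apply/eqP/eq_big => b; last by rewrite mulrC.
by rewrite andbC -val_eqE lt0n.
Qed.

Lemma subst_pow_Eplus0 r : (0 < r)%N -> subst_pow r (Eplus_ser 0) = 1.
Proof.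
move=> r0; rewrite subst_pow_Eplus_rec // big1 ?subr0 ?subst_pow_Hser0 // => b.
by rewrite leqn0 double_eq0 => /andP[/gtn_eqF->].
Qed.

(** * Weights of monomials *)

Definition mblocks (m : monom) : seq (nat * nat) :=
  [seq (v.1.+1, m v) | v <- finsupp m].

Definition stat (s : seq (nat * nat)) : nat :=
  (\sum_(b <- s) b.1 ^ 2 * b.2.+1)%N.

Lemma perm_stat s t : perm_eq s t -> stat s = stat t.
Proof. exact: perm_big. Qed.

Lemma stat_cat s t : stat (s ++ t) = (stat s + stat t)%N.
Proof. exact: big_cat. Qed.

Lemma stat_mblocks m :
  stat (mblocks m) = (\sum_(v <- finsupp m) v.1.+1 ^ 2 * (m v).+1)%N.
Proof. by rewrite /stat big_map. Qed.

Lemma mulcm_coprime (a b : monom) v :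
  [disjoint finsupp a & finsupp b]%fset -> v \in finsupp a -> b v = 0%N.
Proof. by move=> /fdisjointP ab /ab; rewrite -cmE_eq0 => /eqP. Qed.

Lemma perm_mblocksM (a b : monom) : [disjoint finsupp a & finsupp b]%fset ->
  perm_eq (mblocks (mulcm a b)) (mblocks a ++ mblocks b).
Proof.
move=> ab; have ba : [disjoint finsupp b & finsupp a]%fset by rewrite fdisjoint_sym.
have perm_ab : perm_eq (finsupp (mulcm a b)) (finsupp a ++ finsupp b).
  apply: uniq_perm; rewrite ?fset_uniq // ?cat_uniq ?fset_uniq ?andbT /=.
    apply/hasPn => v vb; apply/negP => va.
    by have := mulcm_coprime ab va; apply/eqP; rewrite cmE_neq0.
  by move=> v; rewrite mdomD in_fsetU mem_cat.
rewrite (perm_trans (perm_map _ perm_ab)) // map_cat.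
rewrite (_ : map _ (finsupp a) = mblocks a) 1?(_ : map _ (finsupp b) = mblocks b) //.
  by apply/eq_in_map => v vb; rewrite mulcmE (mulcm_coprime ba).
by apply/eq_in_map => v va; rewrite mulcmE (mulcm_coprime ab) ?addn0.
Qed.

(** Writing the [+1] as an indicator makes the summand vanish off the support, so weights of several
    monomials can be compared over one index set. *)
Lemma stat_mblocksE (m : monom) (D : {fset nat * nat}) : (finsupp m `<=` D)%fset ->
  stat (mblocks m) = (\sum_(v <- D) v.1.+1 ^ 2 * (m v + (m v != 0)))%N.
Proof.
move=> mD; rewrite stat_mblocks -(big_fset_incl _ mD) /=.
  by apply: eq_big_seq => v; rewrite -cmE_neq0 => ->; rewrite addn1.
by move=> v _; rewrite -cmE_neq0 negbK => /eqP->; rewrite muln0.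
Qed.

(** A shared variable contributes one [+1] to the product but two to the sum of weights. *)
Lemma stat_mblocksM_lt (a b : monom) :
  ~~ [disjoint finsupp a & finsupp b]%fset ->
  (stat (mblocks (mulcm a b)) < stat (mblocks a) + stat (mblocks b))%N.
Proof.
rewrite -fsetI_eq0 => /fset0Pn[v]; rewrite in_fsetI => /andP[va vb].
rewrite (stat_mblocksE (fsubsetUl (finsupp a) (finsupp b))).
rewrite (stat_mblocksE (fsubsetUr (finsupp a) (finsupp b))).
rewrite (stat_mblocksE (fsubset_refl _)) mdomD -big_split /=.
rewrite (big_fsetD1 v) ?in_fsetU ?va //= [ltnRHS](big_fsetD1 v) ?in_fsetU ?va //=.
rewrite -addSn leq_add //.
  by move: va vb; rewrite -!cmE_neq0 mulcmE; case: (a v) (b v) => [|i] [|j] // _ _; nia.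
apply: leq_sum => w _; rewrite mulcmE -mulnDr leq_mul2l.
by case: (a w) (b w) => [|i] [|j]; lia.
Qed.

(** Equality occurs when [a] is a single variable of degree [d]. Otherwise every variable of [a] has
    degree below [d]; bound [r * a w + 1] by [r.+1 * a w], then one factor [w.1.+1] by [d]. *)
Lemma stat_mblocksX (a : monom) d r : (0 < d)%N -> (0 < r)%N -> wdeg a = d ->
  (stat (mblocks (expcmn a r)) < d ^ 2 * r.+1)%N \/
  mblocks (expcmn a r) = [:: (d, r)].
Proof.
move=> d0 r0 deg_a.
have /fset0Pn[v va] : finsupp a != fset0.
  by apply: contraTneq d0 => a0; rewrite -deg_a /wdeg a0 big_seq_fset0.
have av0 : (0 < a v)%N by rewrite lt0n cmE_neq0.
have degD1 (w : nat * nat) : w \in finsupp a -> d = (a w * w.1.+1 +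
    \sum_(u <- (finsupp a `\ w)%fset) a u * u.1.+1)%N.
  by move=> wa; rewrite -deg_a /wdeg (big_fsetD1 w).
have [eq_d|neq_d] := eqVneq v.1.+1 d.
  (* A variable of degree [d] already uses up the whole degree of [a]. *)
  right; have av1 : a v = 1%N by have := degD1 v va; rewrite eq_d; nia.
  have fa : finsupp a = [fset v]%fset.
    apply/fsetP => w; rewrite in_fset1; apply/idP/eqP => [wa|->//].
    have := degD1 v va; apply: contra_eq => wv.
    rewrite (big_fsetD1 w) /=; last by rewrite in_fsetD1 wv.
    have p0 : (0 < a w * w.1.+1)%N by rewrite muln_gt0 lt0n cmE_neq0 wa.
    by rewrite eq_d av1 mul1n neq_ltn -[ltnLHS]addn0 ltn_add2l ltn_addr.
  by rewrite /mblocks finsupp_expcmn // fa enum_fsetE enum_fset1 /= expcmnE av1 muln1 eq_d.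
left; rewrite stat_mblocks finsupp_expcmn //.
have le_d (w : nat * nat) : w \in finsupp a -> (a w * w.1.+1 <= d)%N.
  by move=> wa; rewrite [leqRHS](degD1 w wa) leq_addr.
(* The first bound uses that exponents on the support are at least 1; the second is strict at [v],
   whose degree is below [d]. *)
apply: (@leq_ltn_trans (r.+1 * \sum_(w <- finsupp a) (a w * w.1.+1) * w.1.+1)).
  rewrite big_distrr /= big_seq [leqRHS]big_seq; apply: leq_sum => w.
  rewrite -cmE_neq0 -lt0n expcmnE => aw0.
  rewrite -mulnA mulnn [leqRHS]mulnA [leqRHS]mulnC.
  by apply: leq_mul => //; rewrite mulSn; apply: leq_add aw0 (leqnn _).
rewrite mulnC ltn_pmul2r // expnS expn1 -{2}deg_a /wdeg big_distrr /=.
rewrite (big_fsetD1 v) //= [ltnRHS](big_fsetD1 v) //= -addSn leq_add //.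
  rewrite [ltnRHS]mulnC ltn_pmul2l ?muln_gt0 ?av0 // ltn_neqAle neq_d.
  exact: leq_trans (leq_pmull _ av0) (le_d v va).
rewrite big_seq [leqRHS]big_seq; apply: leq_sum => w; rewrite in_fsetD1.
case/andP=> _ wa; rewrite [leqRHS]mulnC leq_mul2l.
by rewrite (leq_trans _ (le_d w wa)) ?orbT // leq_pmull // lt0n cmE_neq0.
Qed.

(** * Monomials occurring in products of [H] *)

(** On [blocks t] this is [of_typ Hser t]; arbitrary lists of blocks allow induction. *)
Definition Hprod (s : seq (nat * nat)) : series :=
  \prod_(b <- s) subst_pow b.2 (Hser b.1).

Definition pos_block (b : nat * nat) : bool := (0 < b.1)%N && (0 < b.2)%N.

Lemma Hprod_cons b s : Hprod (b :: s) = subst_pow b.2 (Hser b.1) * Hprod s.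
Proof. exact: big_cons. Qed.

(** Split [m] as [a^r] times a monomial of the remaining product. Weight is lost if the two share a
    variable or if either factor is already below its bound; otherwise the block lists
    concatenate. *)
Lemma Hprod_stat s m : all pos_block s -> Hprod s m != 0 ->
  (stat (mblocks m) < stat s)%N \/ perm_eq (mblocks m) s.
Proof.
elim: s m => [|[d r] s IHs] m /=.
  rewrite /Hprod big_nil series1E pnatr_eq0 eqb0 negbK.
  move=> _ /eqP->; right; rewrite /mblocks.
  by rewrite (_ : finsupp _ = fset0) ?enum_fsetE ?enum_fset0 //; apply: mdom1.
case/andP=> /andP[/= d0 r0] /IHs{}IHs; rewrite Hprod_cons => /series_mul_neq0[x [y [-> ]]].
move=> /subst_pow_neq0[a -> Ha] /IHs{IHs} IHs.
have {Ha} deg_a : wdeg a = d by move: Ha; rewrite pnatr_eq0 eqb0 negbK => /eqP.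
have statC : stat ((d, r) :: s) = (d ^ 2 * r.+1 + stat s)%N by rewrite /stat big_cons.
have le_y : (stat (mblocks y) <= stat s)%N.
  by case: IHs => [/ltnW//|/perm_stat->].
have le_x : (stat (mblocks (expcmn a r)) <= d ^ 2 * r.+1)%N.
  by case: (stat_mblocksX d0 r0 deg_a) => [/ltnW//|->]; rewrite /stat big_seq1.
have [xy|/stat_mblocksM_lt] := boolP [disjoint finsupp (expcmn a r) & finsupp y]%fset; last first.
  by move=> lt_xy; left; rewrite statC (leq_trans lt_xy) // leq_add.
have := perm_mblocksM xy; move=> /[dup] /perm_stat; rewrite stat_cat => stat_xy perm_xy.
case: IHs => [lt_y|perm_y]; first by left; rewrite statC stat_xy -addnS leq_add.
case: (stat_mblocksX d0 r0 deg_a) => [lt_x|eq_x].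
  by left; rewrite statC stat_xy -addSn leq_add.
by right; rewrite (perm_trans perm_xy) // eq_x /= perm_cons.
Qed.

(** Excludes cancellation when a positive coefficient is exhibited below. *)
Lemma Hprod_ge0 s m : 0 <= Hprod s m.
Proof.
elim: s m => [|b s IHs] m; first by rewrite /Hprod big_nil series1E ler0n.
rewrite Hprod_cons series_mulE sumr_ge0 // => d _; rewrite mulr_ge0 //.
by rewrite /subst_pow sumr_ge0 // => a _; apply: ler0n.
Qed.

(** The witness is a product of powers [x_(d,j)^r], one for each block [d^r], with distinct second
    indices [j]. *)
Lemma Hprod_gt0 s : all pos_block s ->
  exists2 m, 0 < Hprod s m & perm_eq (mblocks m) s.
Proof.
(* The added bound on second indices makes [size s] a fresh index in the induction step. *)
move=> s0; suff [m [m1 m2 _]] : exists m, [/\ 0 < Hprod s m, perm_eq (mblocks m) s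
    & forall v, v \in finsupp m -> (v.2 < size s)%N] by exists m.
elim: s s0 => [_|[d r] s IHs /= /andP[/andP[/= d0 r0] /IHs{IHs}[m [m_gt0 perm_m lt_m]]]].
  exists (onecm _); split; first by rewrite /Hprod big_nil series1E eqxx.
    by rewrite /mblocks (_ : finsupp _ = fset0) ?enum_fsetE ?enum_fset0 //; apply: mdom1.
  by move=> v; rewrite (_ : finsupp _ = fset0) //; apply: mdom1.
pose u : monom := ucm (d.-1, size s).
have fu : finsupp (expcmn u r) = [fset (d.-1, size s)]%fset.
  by rewrite finsupp_expcmn // mdomU.
have disj : [disjoint finsupp (expcmn u r) & finsupp m]%fset.
  by rewrite fu fdisjoint1X; apply/negP => /lt_m; rewrite ltnn.
exists (mulcm (expcmn u r) m); split.
- rewrite Hprod_cons series_mulE (bigD1_seq (expcmn u r)) ?mdivisors_uniq //=; last first.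
    by apply/mem_mdivisors => v; rewrite mulcmE leq_addr.
  rewrite ltr_pwDl ?sumr_ge0 // => [|e _]; last first.
    rewrite mulr_ge0 ?Hprod_ge0 // /subst_pow sumr_ge0 // => a _; exact: ler0n.
  rewrite subst_pow_expcmn // mulr_gt0 //.
    rewrite /Hser (_ : wdeg u = d) ?eqxx // /wdeg mdomU big_seq_fset1 ucmE eqxx mul1n.
    exact: prednK.
  rewrite (_ : divcm _ _ = m) //.
  by apply/eqP/cmP => v; rewrite divcmE mulcmE addKn.
- rewrite (perm_trans (perm_mblocksM disj)) // {1}/mblocks fu enum_fsetE enum_fset1 /=.
  by rewrite expcmnE ucmE eqxx muln1 prednK // perm_cons.
- move=> v; rewrite mdomD in_fsetU fu in_fset1 => /orP[/eqP->//|/lt_m lt_v].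
  exact: ltnW.
Qed.

(** * Types and linear independence *)

Lemma big_blocks (R : Type) (idx : R) (op : Monoid.com_law idx) n (t : typ n)
    (G : nat * nat -> R) :
  \big[op/idx]_(b <- blocks t) G b
  = \big[op/idx]_(i < n) \big[op/idx]_(d <- tnth t i) G (d, i.+1).
Proof.
rewrite /blocks big_flatten big_image /=.
by apply: eq_bigr => i _; rewrite big_map.
Qed.

Lemma count_blocks n (t : typ n) d (i : 'I_n) :
  count_mem (d, i.+1) (blocks t) = count_mem d (tnth t i).
Proof.
rewrite -sum1_count big_mkcond big_blocks (bigD1 i) //= -sum1_count [RHS]big_mkcond.
rewrite [X in (_ + X)%N]big1 ?addn0 => [|j neq_ji].
  by apply: eq_bigr => e _; rewrite xpair_eqE eqxx andbT.
by rewrite big1 // => e _; rewrite xpair_eqE eqSS [j == i :> nat](negPf neq_ji) andbF.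
Qed.

(** Each component is sorted, hence determined by the multiplicities of its parts, which
    [count_blocks] reads off the blocks. *)
Lemma perm_blocks_inj n (t t' : typ n) : perm_eq (blocks t) (blocks t') -> t = t'.
Proof.
move=> /permP eq_count; apply/val_inj/eq_from_tnth => i.
have /andP[st _] := typ_part t i; have /andP[st' _] := typ_part t' i.
apply: (sorted_eq _ _ st st') => [y x z /= yx zy|x y /=|].
- exact: leq_trans zy yx.
- by rewrite andbC; apply: anti_leq.
by apply/allP => d _; rewrite /= -!count_blocks eq_count.
Qed.

Lemma pos_blocks n (t : typ n) : all pos_block (blocks t).
Proof.
apply/allP => b /flattenP[s /imageP[i _ ->] /mapP[d d_in ->]].
rewrite /pos_block /= andbT lt0n; apply: contraTneq d_in => ->.
by have /andP[] := typ_part t i.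
Qed.

(** Collect the degrees of the blocks of each multiplicity and sort them. *)
Lemma typ_of_blocks n (s : seq (nat * nat)) : all pos_block s ->
    (\sum_(b <- s) b.1 * b.2)%N = n ->
  exists t : typ n, perm_eq (blocks t) s.
Proof.
move=> s_pos s_n; pose row (i : 'I_n) := [seq b.1 | b <- s & b.2 == i.+1].
(* Degrees are positive, so every multiplicity is at most [n] and no block falls outside the [n]
   stored components. *)
have le_n b : b \in s -> (b.2 <= n)%N.
  move=> bs; rewrite -s_n (big_rem b) //= (leq_trans _ (leq_addr _ _)) //.
  by rewrite leq_pmull //; case/andP: (allP s_pos b bs).
have eq_n : (\sum_(i < n) i.+1 * sumn (sort geq (row i)))%N = n.
  have rowE (i : 'I_n) : (i.+1 * sumn (sort geq (row i)) =
      \sum_(b <- s | b.2 == i.+1) b.1 * b.2)%N.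
    rewrite sumnE (perm_big _ (permEl (perm_sort geq _))) big_map big_filter.
    by rewrite big_distrr; apply: eq_bigr => b /eqP->; rewrite mulnC.
  rewrite -[RHS]s_n (eq_bigr _ (fun i _ => rowE i)).
  rewrite (exchange_big_dep xpredT) //= big_seq [RHS]big_seq; apply: eq_bigr => b bs.
  have [r0 le_b] : (0 < b.2)%N /\ (b.2 <= n)%N.
    by split; [case/andP: (allP s_pos b bs) | apply: le_n].
  have lt_b : (b.2.-1 < n)%N by rewrite prednK.
  by rewrite (big_pred1 (Ordinal lt_b)) // => i; rewrite [RHS]eq_sym -[RHS]val_eqE /= -[RHS]eqSS prednK.
have ok : all is_partition [tuple sort geq (row i) | i < n] &&
    ((\sum_(i < n) i.+1 * sumn (tnth [tuple sort geq (row i) | i < n] i))%N == n).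
  apply/andP; split; last by under eq_bigr do rewrite tnth_mktuple; apply/eqP.
  apply/all_tnthP => i; rewrite tnth_mktuple /is_partition sort_sorted; last first.
    by move=> x y; apply: leq_total.
  rewrite mem_sort; apply/mapP => -[b]; rewrite mem_filter => /andP[_ /(allP s_pos)].
  by case/andP=> + _; rewrite lt0n => /eqP neq0 /esym.
exists (Typ ok); apply/allP => -[d r] dr_in; rewrite /=.
have : pos_block (d, r) && (r <= n)%N.
  move: dr_in; rewrite mem_cat => /orP[bt|bs]; last by rewrite (allP s_pos) ?(le_n _ bs).
  rewrite (allP (pos_blocks (Typ ok))) //=.
  by case/flattenP: bt => _ /imageP[i _ ->] /mapP[e _ [_ ->]].
case/andP=> /andP[_ /= r0] le_r.
have lt_r : (r.-1 < n)%N by rewrite prednK.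
have := count_blocks (Typ ok) d (Ordinal lt_r); rewrite /= prednK // => ->.
rewrite tnth_mktuple (permP (permEl (perm_sort geq _))) count_map count_filter /=.
by rewrite prednK //; apply/eqP/eq_count => -[e k].
Qed.

(* If [c rho != c' rho] with [stat (blocks rho)] maximal, then [of_typ Hser rho]
   is the only term contributing to the coefficient of a monomial whose blocks
   are those of [rho]. *)
Lemma of_typ_Hser_free n (c c' : typ n -> rat) :
  \sum_rho c rho *: of_typ Hser rho = \sum_rho c' rho *: of_typ Hser rho ->
  c =1 c'.
Proof.
move=> eq_cc' rho0; apply/eqP/negPn/negP => neq0.
case: (@arg_maxnP _ rho0 (fun rho => c rho != c' rho) (fun rho => stat (blocks rho)) neq0).
move=> rho neq_rho max_rho.
have [m m_gt0 perm_m] := Hprod_gt0 (pos_blocks rho).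
have := congr1 (fun f : series => f m) eq_cc'; rewrite !series_sumE => /eqP.
rewrite -subr_eq0 -sumrB (bigD1 rho) //= big1 => [|t t_rho].
  rewrite addr0 !series_scaleE -mulrBl mulf_eq0.
  by rewrite subr_eq0 (negPf neq_rho) (gt_eqF m_gt0).
rewrite !series_scaleE -mulrBl.
have [->|neq_t] := eqVneq (c t) (c' t); first by rewrite subrr mul0r.
apply/eqP; rewrite mulf_eq0 orbC; apply/orP; left; apply: contraNT t_rho.
case/(Hprod_stat (pos_blocks t)) => [|perm_t].
  by rewrite (perm_stat perm_m) ltnNge => /negP[]; apply: max_rho.
by apply/eqP/perm_blocks_inj; rewrite -(permPl perm_t).
Qed.

(** * Rows of tabloids *)

Section Rows.
Variable n : nat.
Implicit Types (i r : 'I_n) (u v : tile n) (R T : {set tile n}) (L : nat).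

Definition tend u : nat := (tstart u + tlen u)%N.

Definition cover_mult R (c : nat) : nat :=
  #|[set u in R | (tstart u <= c < tend u)%N]|.

Definition bricks R : {set tile n} := [set u in R | ~~ tdouble u].

Definition in_row i r L u : bool :=
  [&& tfactor u == i, trow u == r, (0 < tlen u)%N, (tend u <= L)%N
    & tdouble u ==> ~~ odd (tlen u)].

(** The tabloid conditions for a single row, with [L] a free parameter so that the row can be
    shortened in an induction. *)
Definition row_tabloid i r L R : bool :=
  [&& [forall u in R, in_row i r L u],
      [forall c : 'I_n, (c < L)%N ==> (cover_mult R c == 1%N)],
      [forall u in R, forall v in R,
         ~~ tdouble u && tdouble v ==> (tstart u < tstart v)%N]
    & (#|bricks R| <= 1)%N].

Lemma row_tabloidP i r L R : (L <= n)%N ->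
  reflect [/\ forall u, u \in R -> in_row i r L u,
              forall c, (c < L)%N -> cover_mult R c = 1%N,
              forall u v, u \in R -> v \in R -> ~~ tdouble u -> tdouble v ->
                (tstart u < tstart v)%N
            & (#|bricks R| <= 1)%N]
          (row_tabloid i r L R).
Proof.
move=> le_L; apply: (iffP and4P) => [[in_R cov ord le1]|[in_R cov ord le1]].
  split=> // [u|c lt_c|u v uR vR u_brick v_double].
  - exact: (forall_inP in_R).
  - have lt_cn := leq_trans lt_c le_L.
    by apply/eqP/(implyP (forallP cov (Ordinal lt_cn))).
  have /implyP := forall_inP (forall_inP ord u uR) v vR.
  by rewrite u_brick v_double; apply.
split=> //; first exact/forall_inP.
  by apply/forallP => c; apply/implyP => /cov/eqP.
apply/forall_inP => u uR; apply/forall_inP => v vR; apply/implyP => /andP[].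
exact: ord.
Qed.

Lemma cover_multD1 R u c : u \in R ->
  cover_mult R c = ((tstart u <= c < tend u) + cover_mult (R :\ u) c)%N.
Proof.
move=> uR; rewrite /cover_mult (cardsD1 u) inE uR; congr (_ + _)%N.
by apply: eq_card => v; rewrite !inE andbA.
Qed.

Lemma bricksD1 R u : tdouble u -> bricks (R :\ u) = bricks R.
Proof.
move=> u_double; apply/setP => v; rewrite !inE; case: eqVneq => [->|//].
by rewrite u_double /= andbF.
Qed.

Lemma row_tabloid_disjoint R u v (c : nat) : cover_mult R c = 1%N ->
  u \in R -> v \in R -> (tstart u <= c < tend u)%N -> (tstart v <= c < tend v)%N ->
  u = v.
Proof.
move=> cov uR vR uc vc; apply/eqP/negPn/negP => neq_uv; move: cov.
rewrite (cover_multD1 _ uR) (@cover_multD1 _ v); last by rewrite in_setD1 eq_sym neq_uv.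
by rewrite uc vc.
Qed.

(** The tile covering cell [L - 1] must end at [L], since no tile goes beyond. The boolean equation
    is the form that [big_pred1] takes. *)
Lemma row_tabloid_last i r L R : (0 < L <= n)%N -> row_tabloid i r L R ->
  exists u, forall v, (v \in R) && (tend v == L) = (v == u).
Proof.
case/andP=> L0 le_L /(row_tabloidP _ _ _ le_L)[in_R cov _ _].
have /eqP/cards1P[u cov_u] : cover_mult R L.-1 = 1%N by apply: cov; lia.
exists u => v; have /setP/(_ v) := cov_u; rewrite !inE => <-.
have [/in_R|//] := boolP (v \in R).
by rewrite /in_row /tend => /and5P[_ _ v0 le_v _]; apply/eqP/andP; lia.
Qed.

(** A doublebrick at the right end satisfies the order condition automatically and does not count as
    a brick, so removing it leaves an arbitrary tabloid of the shorter row. *)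
Lemma row_tabloid_double i r L R u : (L <= n)%N -> u \in R -> tend u = L ->
  tdouble u ->
  row_tabloid i r L R = in_row i r L u && row_tabloid i r (L - tlen u) (R :\ u).
Proof.
move=> le_L uR end_u u_double.
have le_L' : (L - tlen u <= n)%N by rewrite (leq_trans (leq_subr _ _)).
have start_u : (L - tlen u = tstart u)%N by rewrite -end_u addnK.
apply/(row_tabloidP _ _ _ le_L)/andP => [[in_R cov ord le1]|].
  have u_row := in_R u uR; split=> //; apply/row_tabloidP => //; split.
  - move=> v; rewrite in_setD1 => /andP[neq_vu vR]; have := in_R v vR.
    case/and5P=> vi vr v0 le_v v_even; rewrite /in_row vi vr v0 v_even !andbT /=.
    (* If [v] ran past the start of [u], its last cell would be covered by [u] too. *)
    rewrite start_u leqNgt; apply: contraNN neq_vu => lt_uv; apply/eqP.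
    have lt_c : ((tend v).-1 < L)%N by move: v0 le_v; rewrite /tend; lia.
    apply: row_tabloid_disjoint (cov _ lt_c) vR uR _ _.
      by move: v0; rewrite /tend; lia.
    by move: lt_uv lt_c; rewrite end_u; lia.
  - move=> c lt_c; have lt_cL : (c < L)%N by lia.
    have := cov c lt_cL; rewrite (cover_multD1 _ uR) leqNgt -start_u lt_c.
    by rewrite add0n.
  - by move=> v w /setD1P[_ vR] /setD1P[_ wR]; apply: ord.
  - by rewrite bricksD1.
case=> u_row /(row_tabloidP _ _ _ le_L')[in_R cov ord le1]; split.
- move=> v vR; have [->//|neq_vu] := eqVneq v u.
  have /and5P[vi vr v0 le_v v_even] : in_row i r (L - tlen u) v.
    by apply: in_R; rewrite in_setD1 neq_vu.
  by rewrite /in_row vi vr v0 v_even (leq_trans le_v) ?leq_subr.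
- move=> c lt_c; rewrite (cover_multD1 _ uR) end_u lt_c andbT -start_u.
  have [lt_c'|ge_c] := ltnP c (L - tlen u); first by rewrite cov.
  (* From the start of [u] on, no other tile covers a cell: all of them end by [L - tlen u]. *)
  rewrite (_ : cover_mult _ _ = 0%N) //; apply: eq_card0 => v; rewrite inE.
  apply/andP => -[/in_R /and5P[_ _ _ le_v _] /andP[_ lt_v]].
  by have := leq_trans lt_v le_v; rewrite ltnNge ge_c.
- move=> v w vR wR v_brick w_double.
  have vR' : v \in R :\ u.
    by rewrite in_setD1 vR andbT; apply: contraNneq v_brick => ->.
  have [->|neq_wu] := eqVneq w u; last by apply: ord; rewrite // in_setD1 neq_wu.
  have /and5P[_ _ v0 le_v _] := in_R v vR'.
  by move: v0 le_v; rewrite start_u /tend; lia.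
by rewrite -(bricksD1 _ u_double).
Qed.

(** A brick at the right end is alone: a second brick is excluded, and a doublebrick would have to
    start to its right. *)
Lemma row_tabloid_brick i r L R u : (L <= n)%N -> u \in R -> tend u = L ->
  ~~ tdouble u ->
  row_tabloid i r L R = [&& in_row i r L u, tstart u == 0%N :> nat & R == [set u]].
Proof.
move=> le_L uR end_u u_brick.
apply/(row_tabloidP _ _ _ le_L)/and3P => [[in_R cov ord le1]|].
  have u_row := in_R u uR.
  have defR : R = [set u].
    apply/setP => v; rewrite in_set1; apply/idP/eqP => [vR|->//].
    have [v_double|v_brick] := boolP (tdouble v); last first.
      by apply: (card_le1_eqP le1); rewrite inE ?uR ?vR.
    have /and5P[_ _ v0 le_v _] := in_R v vR.
    have lt_uv := ord u v uR vR u_brick v_double.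
    (* The doublebrick [v] starts after [u] starts and before [L], so its first cell lies in [u]. *)
    have lt_c : (tstart v < L)%N by move: v0 le_v; rewrite /tend; lia.
    apply: row_tabloid_disjoint (cov _ lt_c) vR uR _ _; last by rewrite end_u ltnW.
    by rewrite leqnn /tend; lia.
  split=> //; last exact/eqP.
  have /and5P[_ _ u0 le_u _] := u_row.
  have L0 : (0 < L)%N by rewrite -end_u /tend; lia.
  have := cov 0%N L0; rewrite (cover_multD1 _ uR) defR setDv.
  rewrite (_ : cover_mult set0 _ = 0%N) ?addn0; last first.
    by apply: eq_card0 => v; rewrite !inE.
  by rewrite leqn0; case: (_ == _).
case=> u_row /eqP start_u /eqP->; split.
- by move=> v /set1P->.
- move=> c lt_c; rewrite (@cover_multD1 _ u) ?set11 // start_u end_u lt_c setDv.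
  by apply/eqP; rewrite eqSS; apply/eqP/eq_card0 => v; rewrite !inE.
- by move=> v w /set1P-> /set1P-> /negPf->.
rewrite (leq_trans (subset_leq_card _) (eq_leq (cards1 u))) //.
by rewrite /bricks setIdE subsetIl.
Qed.

(** * Signed generating function of a row *)

Definition tile_series u : series :=
  (-1) ^+ tdouble u * subst_pow (tile_block u).2 (Hser (tile_block u).1).

Lemma row_tabloid0 i r R : row_tabloid i r 0 R = (R == set0).
Proof.
apply/(row_tabloidP _ _ _ (leq0n n))/eqP => [[in_R _ _ _]|->].
  apply/setP => u; rewrite in_set0; apply/negP => /in_R/and5P[_ _ + + _].
  by rewrite /tend leqn0 addn_eq0 [tlen u == _ :> nat]eqn0Ngt andbC => ->.
by split=> [u|//|u v|]; rewrite ?in_set0 // /bricks setIdE set0I cards0.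
Qed.

Lemma sum_row_tabloid_double i r L u : (L <= n)%N -> tend u = L -> tdouble u ->
  \sum_(R | row_tabloid i r L R && (u \in R)) \prod_(v in R) tile_series v =
  if in_row i r L u then
    tile_series u * \sum_(R | row_tabloid i r (L - tlen u) R) \prod_(v in R) tile_series v
  else 0.
Proof.
move=> le_L end_u u_double; case: ifP => u_row; last first.
  rewrite big1 // => R /andP[R_tab uR]; move: R_tab.
  by rewrite (row_tabloid_double _ _ le_L uR) // u_row.
rewrite (reindex_onto (fun R => u |: R) (fun R => R :\ u)) /=; last first.
  by move=> R /andP[_ uR]; rewrite setD1K.
rewrite big_distrr /=; apply: eq_big => [R|R /andP[_ /eqP eq_R]]; last first.
  rewrite big_setU1 //=; apply/negP => uR.
  by move/setP/(_ u): eq_R; rewrite !inE eqxx uR.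
rewrite setU11 andbT (row_tabloid_double _ _ le_L (setU11 _ _)) // u_row /=.
apply/andP/idP => [[+ /eqP eq_R]|R_tab]; first by rewrite eq_R.
suff -> : (u |: R) :\ u = R by [].
(* A tile ending at [L] does not fit in a row of length [L - tlen u]. *)
apply/setU1K/negP => uR.
have le_L' : (L - tlen u <= n)%N by rewrite (leq_trans (leq_subr _ _)).
have [in_R _ _ _] := row_tabloidP _ _ _ le_L' R_tab.
have /and5P[_ _ u0 le_u _] := in_R u uR.
by move: u0 le_u end_u; rewrite /tend; lia.
Qed.

Lemma sum_row_tabloid_brick i r L u : (L <= n)%N -> tend u = L -> ~~ tdouble u ->
  \sum_(R | row_tabloid i r L R && (u \in R)) \prod_(v in R) tile_series v =
  if in_row i r L u && (tstart u == 0 :> nat)%N then tile_series u else 0.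
Proof.
move=> le_L end_u u_brick; case: ifP => u_row; last first.
  rewrite big1 // => R /andP[R_tab uR]; move: R_tab.
  by rewrite (row_tabloid_brick _ _ le_L uR) // andbA u_row.
rewrite (big_pred1 [set u]) ?big_set1 // => R; apply/andP/eqP => [[+ uR]|->].
  by rewrite (row_tabloid_brick _ _ le_L uR) // andbA u_row => /eqP.
by rewrite (row_tabloid_brick _ _ le_L (set11 u)) // set11 andbA u_row eqxx.
Qed.

(** Strong induction on [L], classifying tabloids by their last tile, reproduces
    [subst_pow_Eplus_rec]. *)
Lemma sum_row_tabloid i r L : (L <= n)%N ->
  \sum_(R | row_tabloid i r L R) \prod_(u in R) tile_series u
  = subst_pow i.+1 (Eplus_ser L).
Proof.
elim/ltn_ind: L => L IHL le_L; have [->|L0] := posnP L.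
  rewrite (eq_bigl _ _ (row_tabloid0 i r)) big_pred1_eq big_set0.
  exact/esym/subst_pow_Eplus0.
(* Exactly one tile ends at [L], so a sum over the last tile can be inserted and moved outside. *)
have sum_last R : row_tabloid i r L R -> \prod_(u in R) tile_series u =
    \sum_(v | tend v == L) if v \in R then \prod_(u in R) tile_series u else 0.
  case/row_tabloid_last => [|u last_u]; first by rewrite L0.
  rewrite -big_mkcondr (big_pred1 u) // => v /=; by rewrite andbC last_u.
rewrite (eq_bigr _ sum_last) exchange_big /=.
under eq_bigr do rewrite -big_mkcondr.
rewrite (bigID (@tdouble n)) /= addrC subst_pow_Eplus_rec //; congr (_ + _).
  rewrite (eq_bigr (fun u => if in_row i r L u && (tstart u == 0 :> nat)%N
     then tile_series u else 0)); last first.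
    by move=> u /andP[/eqP end_u u_brick]; apply: sum_row_tabloid_brick.
  rewrite -big_mkcondr /=.
  have lt_0n : (0 < n)%N by apply: leq_trans le_L.
  have lt_L : (L < n.+1)%N by [].
  (* The only admissible last brick fills the whole row and yields the term [H_L]. *)
  pose u := Tile i r (Ordinal lt_0n) (Ordinal lt_L) false.
  rewrite (big_pred1 u) => [|v]; first by rewrite /tile_series expr0 mul1r.
  apply/idP/eqP => [|->]; last first.
    by rewrite /in_row /tend /= !eqxx L0 leqnn.
  case/andP=> /andP[/eqP + v_brick] /andP[/and5P[/eqP + /eqP + _ _ _] /eqP +].
  case: v v_brick => i' r' c l [] //= _; rewrite /tend /= => + -> -> c0.
  rewrite c0 add0n => l_L; rewrite /u.
  by congr Tile; apply: val_inj.
rewrite -sumrN.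
rewrite (eq_bigr (fun u => if in_row i r L u then
   tile_series u * subst_pow i.+1 (Eplus_ser (L - tlen u)) else 0)); last first.
  move=> u /andP[/eqP end_u u_double]; rewrite sum_row_tabloid_double //.
  case: ifP => // /and5P[_ _ u0 _ _]; by rewrite IHL //; lia.
rewrite -big_mkcondr /=.
have n_gt0 : (0 < n)%N by apply: leq_trans le_L.
(* The doublebrick of length [2b] ending at [L]. Where a field would be out of range it takes a
   default value; [condE] shows that such [b] are filtered out. *)
pose tile_of (b : 'I_L.+1) : tile n :=
  Tile i r (insubd (Ordinal n_gt0) (L - b.*2)%N) (inord b.*2) true.
pose half u : 'I_L.+1 := inord (tlen u)./2.
rewrite (reindex_onto tile_of half) /=; last first.
  move=> [i' r' c l b'] /andP[/andP[/eqP]].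
  rewrite /tend /= => end_u -> /and5P[/eqP/= -> /eqP-> l0 _ l_even].
  have half_l : ((inord (l./2) : 'I_L.+1) : nat).*2 = l.
    rewrite inordK; last by rewrite ltnS; lia.
    by rewrite even_halfK.
  rewrite /tile_of /half /= half_l; congr Tile; apply: val_inj => /=.
    rewrite val_insubd; case: ifP => [_|]; first by rewrite -end_u addnK.
    by have := ltn_ord c; rewrite -end_u addnK => ->.
  by rewrite inordK.
have tile_ofE (b : 'I_L.+1) : (0 < b)%N && (b.*2 <= L)%N ->
    (tstart (tile_of b) = L - b.*2 :> nat)%N /\ (tlen (tile_of b) = b.*2 :> nat)%N.
  case/andP=> b0 le_b; split; last by rewrite inordK // ltnS (leq_trans le_b).
  by rewrite val_insubd; case: ifP => //; lia.
have condE (b : 'I_L.+1) :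
    (tend (tile_of b) == L) && true && in_row i r L (tile_of b) &&
    (half (tile_of b) == b) = (0 < b)%N && (b.*2 <= L)%N.
  apply/andP/idP => [[/andP[/andP[/eqP end_b _]]]|b_ok].
    case/and5P=> _ _ b0 _ _ _; move: b0 end_b.
    rewrite /tend /= /inord val_insubd; case: ifP => // _ b0 end_b.
    by rewrite -double_gt0 b0 -[leqRHS]end_b leq_addl.
  have [start_b len_b] := tile_ofE b b_ok; case/andP: b_ok => b0 le_b.
  rewrite /in_row /tend start_b len_b subnK // !eqxx leqnn odd_double double_gt0 b0.
  by split=> //; apply/eqP/val_inj; rewrite /half len_b doubleK /= inordK.
rewrite (eq_bigl _ _ condE); apply: eq_bigr => b b_ok.
have [_ len_b] := tile_ofE b b_ok.
by rewrite -[inord _]/(tlen (tile_of b)) /tile_series /tile_block /= len_b doubleK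
  expr1 mulN1r mulNr.
Qed.
End Rows.

(** * Assembling the rows *)

Lemma row_len_le n (t : typ n) (i : 'I_n) (r : nat) : (row_len t i r <= n)%N.
Proof. exact: leq_trans (sumn_ge_nth _ _) (typ_size t i). Qed.

(** Indices past the last part of a component give rows of length 0, which contribute [idx]; the
    operation can thus run over a fixed square of pairs. *)
Lemma big_row_len (R : Type) (idx : R) (op : Monoid.com_law idx) n (t : typ n)
    (G : nat -> nat -> R) : (forall k, G 0%N k = idx) ->
  \big[op/idx]_(b <- blocks t) G b.1 b.2
  = \big[op/idx]_(p : 'I_n * 'I_n) G (row_len t p.1 p.2) p.1.+1.
Proof.
move=> G0; rewrite big_blocks -(pair_bigA _ (fun i (r : 'I_n) => G (row_len t i r) i.+1)) /=.
apply: eq_bigr => i _; have /andP[_ t0] := typ_part t i.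
have le_n : (size (tnth t i) <= n)%N.
  exact: leq_trans (sumn_ge_size t0) (typ_size t i).
rewrite (big_nth 0%N) big_mkord (big_ord_widen n (fun r => G (row_len t i r) i.+1)) //.
rewrite big_mkcond; apply: eq_bigr => r _; case: ltnP => // ge_r.
by rewrite /row_len nth_default ?G0.
Qed.

Lemma sum_interval a l L : (a + l <= L)%N -> (\sum_(c < L) (a <= c < a + l))%N = l.
Proof.
move=> le_L; transitivity (\sum_(a <= c < a + l) 1)%N; last first.
  by rewrite sum_nat_const_nat addKn muln1.
rewrite (big_nat_widen _ _ L) // (big_nat_widenl _ 0) // big_mkcond big_mkord.
by apply: eq_bigr => c _; rewrite /= andbC; case: (_ <= _ < _)%N.
Qed.

Section Tabloids.
Variables (n : nat) (s : typ n).
Implicit Types (u : tile n) (R T : {set tile n}) (p : 'I_n * 'I_n).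

Definition tile_row u : 'I_n * 'I_n := (tfactor u, trow u).

Definition row_of T p : {set tile n} := [set u in T | tile_row u == p].

(** The content is left free here; the tabloids are sorted by content at the end. *)
Definition H_tabloid T : bool := is_tabloid s T && le1_brick_per_row T.

Lemma row_tabloid_tile_row i r L R u : (L <= n)%N -> row_tabloid i r L R ->
  u \in R -> tile_row u = (i, r).
Proof.
move=> le_L /(row_tabloidP _ _ _ le_L)[in_R _ _ _] /in_R/and3P[/eqP ui /eqP ur _].
by rewrite /tile_row ui ur.
Qed.

(** Every condition is local to a row: cells and tiles lie in one row, and only tiles of the same
    row are compared. *)
Lemma H_tabloid_rows T : H_tabloid T =
  [forall p, row_tabloid p.1 p.2 (row_len s p.1 p.2) (row_of T p)].
Proof.
have bricks_row i r : bricks (row_of T (i, r)) =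
    [set u in T | [&& tfactor u == i, trow u == r & ~~ tdouble u]].
  by apply/setP => u; rewrite !inE xpair_eqE !andbA.
have cover_row i r (c : 'I_n) : cover_mult (row_of T (i, r)) c =
    #|[set u in T | covers u i r c]|.
  by apply: eq_card => u; rewrite !inE xpair_eqE /covers !andbA.
apply/andP/forallP => [[/and3P[in_T cov ord] le1] [i r] /=|row_T].
  apply/and4P; split.
  - apply/forall_inP => u; rewrite inE xpair_eqE => /andP[uT /andP[ui ur]].
    have /and3P[u0 le_u u_even] := forall_inP in_T u uT.
    by rewrite /in_row ui ur u0 u_even -(eqP ui) -(eqP ur) /tend le_u.
  - apply/forallP => c; rewrite cover_row.
    exact: (forallP (forallP (forallP cov i) r) c).
  - apply/forall_inP => u /setIdP[uT /eqP u_row].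
    apply/forall_inP => v /setIdP[vT /eqP v_row].
    have := forall_inP (forall_inP ord u uT) v vT.
    rewrite /same_row; move: u_row v_row; rewrite /tile_row.
    by case=> -> -> [-> ->]; rewrite !eqxx.
  - by rewrite bricks_row; exact: (forallP (forallP le1 i) r).
have rowP u : u \in T -> u \in row_of T (tile_row u) by rewrite inE eqxx andbT.
split; [apply/and3P; split|].
- apply/forall_inP => u uT; have /and4P[in_T _ _ _] := row_T (tile_row u).
  have /and5P[_ _ u0 le_u u_even] := forall_inP in_T u (rowP u uT).
  by rewrite /tile_in u0 le_u u_even.
- apply/forallP => i; apply/forallP => r; apply/forallP => c.
  by have /and4P[_ /forallP/(_ c) + _ _] := row_T (i, r); rewrite cover_row.
- apply/forall_inP => u uT; apply/forall_inP => v vT.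
  apply/implyP => /and3P[/andP[/eqP eq_i /eqP eq_r] u_brick v_double].
  have /and4P[_ _ ord _] := row_T (tile_row u).
  have v_row : v \in row_of T (tile_row u).
    by rewrite inE vT /tile_row eq_i eq_r /=.
  have := forall_inP (forall_inP ord u (rowP u uT)) v v_row.
  by rewrite u_brick v_double.
- apply/forallP => i; apply/forallP => r.
  by have /and4P[_ _ _] := row_T (i, r); rewrite bricks_row.
Qed.

(** Expanding the product of the row sums gives a sum over families of row tabloids. Their union is
    a tabloid, from which the family is recovered because each tile records its row. *)
Lemma of_typ_Eplus_tabloids :
  of_typ Eplus_ser s = \sum_(T | H_tabloid T) \prod_(u in T) tile_series u.
Proof.
have -> : of_typ Eplus_ser s =
    \prod_(p : 'I_n * 'I_n) subst_pow p.1.+1 (Eplus_ser (row_len s p.1 p.2)).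
  (* [k.-1.+1] makes [G 0 k] equal to 1 also at [k = 0]; it agrees with [k] on actual blocks. *)
  rewrite -(big_row_len _ s (G := fun d k => subst_pow k.-1.+1 (Eplus_ser d))); last first.
    by move=> k; apply: subst_pow_Eplus0.
  rewrite /of_typ big_seq [RHS]big_seq; apply: eq_bigr => b /(allP (pos_blocks s)).
  by case/andP=> _ r0; rewrite prednK.
under eq_bigr => p _ do rewrite -(sum_row_tabloid _ p.2 (row_len_le _ _ _)).
rewrite bigA_distr_big_dep /=.
pose rows T : {ffun 'I_n * 'I_n -> {set tile n}} := [ffun p => row_of T p].
pose join (f : {ffun 'I_n * 'I_n -> {set tile n}}) := \bigcup_p f p.
have joinK T : join (rows T) = T.
  apply/setP => u; apply/bigcupP/idP => [[p _]|uT].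
    by rewrite ffunE inE => /andP[].
  by exists (tile_row u); rewrite // ffunE inE uT eqxx.
rewrite (reindex_onto rows join) => [|f /familyP f_row] /=; last first.
  apply/ffunP => p; apply/setP => u; rewrite ffunE inE.
  have row_u q : u \in f q -> tile_row u = q.
    by move=> /(row_tabloid_tile_row (row_len_le _ _ _) (f_row q))->; case: q.
  apply/andP/idP => [[/bigcupP[q _ uq] /eqP <-]|up]; first by rewrite (row_u q uq).
  by rewrite (row_u p up); split=> //; apply/bigcupP; exists p.
apply: eq_big => [T|T _].
  rewrite joinK eqxx andbT H_tabloid_rows; apply/familyP/forallP => row_T p.
    by have := row_T p; rewrite ffunE.
  by rewrite ffunE; apply: row_T.
rewrite [RHS](partition_big tile_row xpredT) //=; apply: eq_bigr => p _.
by apply: eq_bigl => u; rewrite ffunE inE.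
Qed.

(** Count the pairs of a tile and a cell it covers in two ways. *)
Lemma sum_tlen_row i r L R : (L <= n)%N -> row_tabloid i r L R ->
  (\sum_(u in R) tlen u)%N = L.
Proof.
move=> le_L /(row_tabloidP _ _ _ le_L)[in_R cov _ _].
transitivity (\sum_(u in R) \sum_(c < L) (tstart u <= c < tend u))%N.
  apply: eq_bigr => u /in_R/and5P[_ _ _ le_u _].
  by rewrite sum_interval.
rewrite exchange_big /= -[RHS]card_ord -sum1_card; apply: eq_bigr => c _.
rewrite -(cov c (ltn_ord c)) /cover_mult -sum1dep_card big_mkcondr.
by apply: eq_bigr => u _; case: (_ <= _ < _)%N.
Qed.

(** Brick or doublebrick, a tile of length [l] in factor [m] gives a block of total degree [l * m],
    since halving the degree doubles the multiplicity. Summing over cells gives the size [n] of the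
    shape. *)
Lemma tabloid_content T : H_tabloid T -> exists t : typ n, has_content t T.
Proof.
rewrite H_tabloid_rows => /forallP row_T.
have in_T u : u \in T -> (0 < tlen u)%N && (tdouble u ==> ~~ odd (tlen u)).
  move=> uT; have := row_T (tile_row u).
  case/(row_tabloidP _ _ _ (row_len_le _ _ _)) => /(_ u).
  by rewrite inE uT eqxx => /(_ isT)/and5P[_ _ -> _ ->].
have pos_T : all pos_block [seq tile_block u | u in T].
  apply/allP => _ /imageP[u uT ->]; have /andP[u0 /implyP u_even] := in_T u uT.
  rewrite /tile_block /pos_block; case: ifP => [/u_even|] /=; last by rewrite u0.
  by lia.
have deg_T : (\sum_(b <- [seq tile_block u | u in T]) b.1 * b.2)%N = n.
  rewrite big_image /=.
  transitivity (\sum_(p : 'I_n * 'I_n) row_len s p.1 p.2 * p.1.+1)%N; last first.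
    rewrite -(big_row_len _ s (G := fun d k => d * k)%N) //.
    rewrite big_blocks -[RHS](eqP (andP (valP s)).2); apply: eq_bigr => i _ /=.
    by rewrite sumnE big_distrr; apply: eq_bigr => d _; rewrite mulnC.
  rewrite (partition_big tile_row xpredT) //=; apply: eq_bigr => p _.
  rewrite -(sum_tlen_row (row_len_le _ _ _) (row_T p)) big_distrl /=.
  apply: eq_big => [u|u /andP[uT /eqP <-]]; first by rewrite inE.
  have /andP[_ /implyP u_even] := in_T u uT.
  rewrite /tile_block; case: ifP => //= /u_even; set l := tlen u => l_even.
  by rewrite mulnA muln2 even_halfK.
have [t perm_t] := typ_of_blocks pos_T deg_T.
by exists t; rewrite /has_content perm_sym.
Qed.

End Tabloids.

(** Each tabloid has exactly one content, so the sum over tabloids can be regrouped by type. *)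
Lemma of_typ_Eplus_expansion n (s : typ n) :
  of_typ Eplus_ser s =
  \sum_rho (\sum_(T in PT_H_doub s rho) (-1) ^+ ell2 T) *: of_typ Hser rho.
Proof.
rewrite of_typ_Eplus_tabloids.
transitivity (\sum_(T | H_tabloid s T) \sum_(rho | has_content rho T)
   (-1) ^+ ell2 T *: of_typ Hser rho).
  apply: eq_bigr => T /tabloid_content[rho rho_T].
  rewrite (big_pred1 rho) => [|rho' /=]; last first.
    apply/idP/eqP => [rho'_T|->//]; apply: perm_blocks_inj.
    by rewrite -(permPl rho'_T).
  rewrite big_split prodrXr /=.
  have -> : of_typ Hser rho =
     \prod_(u in T) subst_pow (tile_block u).2 (Hser (tile_block u).1).
    by rewrite /of_typ -(perm_big _ rho_T) big_image.
  rewrite (_ : (\sum_(u in T) tdouble u)%N = ell2 T); last first.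
    by rewrite /ell2 -sum1dep_card [RHS]big_mkcondr; apply: eq_bigr => u _; case: tdouble.
  (* The sign moves from a power of -1 in the ring of series to a rational scalar. *)
  by elim: (ell2 T) => [|k IHk]; rewrite ?expr0 ?mul1r ?scale1r // !exprS !mulN1r
    mulNr scaleNr IHk.
rewrite (exchange_big_dep xpredT) //=; apply: eq_bigr => rho _.
rewrite scaler_suml; apply: eq_bigl => T; rewrite inE /H_tabloid.
by rewrite -andbA [has_content _ _ && _]andbC.
Qed.

Theorem theorem45 (n : nat) (sigma tau : typ n) :
  exists c : typ n -> rat,
    [/\ of_typ Eplus_ser sigma = \sum_(rho : typ n) c rho *: of_typ Hser rho,
        forall c' : typ n -> rat,
          of_typ Eplus_ser sigma = \sum_(rho : typ n) c' rho *: of_typ Hser rho ->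
          c' =1 c
      & c tau = \sum_(T in PT_H_doub sigma tau) (-1) ^+ ell2 T].
Proof.
exists (fun rho => \sum_(T in PT_H_doub sigma rho) (-1) ^+ ell2 T).
split=> [|c' def_c'|//]; first exact: of_typ_Eplus_expansion.
by apply: of_typ_Hser_free; rewrite -def_c' of_typ_Eplus_expansion.
Qed.
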